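(* Let $F$ be a field, let $G$ be a bipartite graph on $n$ vertices, and let $k\ge 2$ be an integer. If $\mathcal{I}_F(G)\neq\emptyset$, then $$f(G\Box C_{2k})=n.$$
   Context: All graphs are finite and simple. For a graph $H$ with a perfect matching $M$, a subset $S\subseteq M$ is a forcing set of $M$ if $S$ is contained in no other perfect matching of $H$; the forcing number $f(H,M)$ is the minimum size of a forcing set of $M$, and the minimum forcing number $f(H)$ is the minimum of $f(H,M)$ over all perfect matchings $M$ of $H$. A weighted adjacency matrix of a graph $G$ over a field $F$ is a matrix over $F$ with rows and columns indexed by $V(G)$ whose $(u,v)$ entry is nonzero if and only if $u$ and $v$ are adjacent in $G$. A matrix $A$ is involutory if $A^{-1}=A$ (i.e. $A^2=I$). $\mathcal{I}_F(G)$ denotes the set of weighted adjacency matrices of $G$ over $F$ that are involutory. $C_{2k}$ is the cycle on $2k$ vertices. The Cartesian product $G\Box H$ has vertex set $V(G)\times V(H)$, with $(g_1,h_1)$ and $(g_2,h_2)$ adjacent iff either $g_1=g_2$ and $h_1h_2\in E(H)$, or $h_1=h_2$ and $g_1g_2\in E(G)$. *)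

(* Defs.v *)
From HB Require Import structures.
From mathcomp Require Import all_boot all_order all_algebra.
Set Implicit Arguments. Unset Strict Implicit. Unset Printing Implicit Defensive.
Import GRing.Theory.

Definition simple_graph (V : finType) (e : rel V) : Prop :=
  symmetric e /\ irreflexive e.

Definition bipartite (V : finType) (e : rel V) : Prop :=
  exists c : V -> bool, forall x y, e x y -> c x != c y.

Definition is_edge (V : finType) (e : rel V) (m : {set V}) : bool :=
  [exists u, exists v, e u v && (m == [set u; v])].

Definition perfect_matching (V : finType) (e : rel V) (M : {set {set V}}) : bool :=
  [forall m in M, is_edge e m] &&
  [forall x : V, #|[set m in M | x \in m]| == 1%N].

Definition forcing_set (V : finType) (e : rel V) (M S : {set {set V}}) : bool :=
  (S \subset M) &&
  [forall M' : {set {set V}}, (perfect_matching e M' && (S \subset M')) ==> (M' == M)].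

(* f(H,M): minimum size of a forcing set of M (M itself is one, so the default
   #|M| does not affect the minimum). *)
Definition forcing_number (V : finType) (e : rel V) (M : {set {set V}}) : nat :=
  \big[minn/#|M|]_(S : {set {set V}} | forcing_set e M S) #|S|.

(* f(H): minimum of f(H,M) over perfect matchings M (default #|V| is an upper
   bound for every f(H,M) since f(H,M) <= #|M| <= #|V|). *)
Definition min_forcing_number (V : finType) (e : rel V) : nat :=
  \big[minn/#|V|]_(M : {set {set V}} | perfect_matching e M) forcing_number e M.

Definition cart_prod (V1 V2 : finType) (e1 : rel V1) (e2 : rel V2) : rel (V1 * V2) :=
  fun x y => ((x.1 == y.1) && e2 x.2 y.2) || ((x.2 == y.2) && e1 x.1 y.1).

(* The cycle C_m on vertex set 'I_m (meaningful as a simple graph for m >= 3) *)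
Definition cycle_graph (m : nat) : rel 'I_m :=
  fun i j => (val j == i.+1 %% m) || (val i == j.+1 %% m).
Arguments cycle_graph m : clear implicits.

Definition weighted_adj (F : fieldType) (n : nat) (e : rel 'I_n) (A : 'M[F]_n) : Prop :=
  forall i j, (A i j != 0%R) = e i j.

Definition involutory_wadj (F : fieldType) (n : nat) (e : rel 'I_n) (A : 'M[F]_n) : Prop :=
  weighted_adj e A /\ (A *m A = 1%:M)%R.

(* Main.v *)
Require Import Defs.
From HB Require Import structures.
From mathcomp Require Import all_boot all_order all_algebra.
From mathcomp Require Import ring zify.
Set Implicit Arguments. Unset Strict Implicit. Unset Printing Implicit Defensive.
Import GRing.Theory.

(* Lower bound: over an infinite extension K of F, weight the edges of G x C_2k
   by beta_i A inside layer i and by scalars gamma_i, alpha_i towards layers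
   i + 1, i - 1, where alpha_i + beta_i + gamma_i = 0 and
   alpha_i a_(i-1) + beta_i a_i + gamma_i a_(i+1) = 0 for distinct a_j.  As
   A^2 = 1, the layers x_j = (y + a_j z) A^j form a 2n-dimensional kernel.  A
   kernel vector vanishing on the at most 2|S| vertices of a forcing set S is
   zero, so n <= |S|.
   Upper bound: match along the cycle direction, shifting the matching by one
   on the second colour class; one edge in each copy of the cycle forces it. *)

(** * Minima over a finite type *)

Lemma bigmin_leq (I : finType) (P : pred I) (F : I -> nat) x j :
  P j -> \big[minn/x]_(i | P i) F i <= F j.
Proof.
move=> Pj; have : j \in index_enum I by rewrite mem_index_enum.
elim: (index_enum I) => // i r IH; rewrite inE big_cons => /predU1P[<-|jr].
  by rewrite Pj geq_minl.
by case: ifP => _; [apply: leq_trans (geq_minr _ _) (IH jr) | apply: IH].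
Qed.

Lemma leq_bigmin (I : finType) (P : pred I) (F : I -> nat) x n :
  n <= x -> (forall i, P i -> n <= F i) -> n <= \big[minn/x]_(i | P i) F i.
Proof.
move=> nx nF; elim/big_ind: _ => // a b na nb.
by rewrite leq_min na nb.
Qed.

(** * Perfect matchings as involutions, and kernel vectors vanishing on a forcing set *)

Section Mates.
Variables (V : finType) (e : rel V).
Implicit Types (m : V -> V) (M S : {set {set V}}).

Definition mate_edges m : {set {set V}} := [set [set v; m v] | v : V].

Definition is_mate m := (forall v, e v (m v)) /\ involutive m.

Lemma mate_edges_perfect m : is_mate m -> perfect_matching e (mate_edges m).
Proof.
case=> em mK; apply/andP; split.
  apply/forall_inP => _ /imsetP[v _ ->].
  by apply/existsP; exists v; apply/existsP; exists (m v); rewrite em eqxx.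
apply/forallP => x; rewrite (_ : [set _ in _ | _] = [set [set x; m x]]) ?cards1//.
apply/setP => A; rewrite !inE; apply/andP/eqP => [[/imsetP[v _ ->]]|->].
  by rewrite !inE => /orP[/eqP-> //|/eqP->]; rewrite mK setUC.
by split; [apply/imsetP; exists x | rewrite !inE eqxx].
Qed.

Lemma perfect_matching_inj M A B x : perfect_matching e M ->
  A \in M -> B \in M -> x \in A -> x \in B -> A = B.
Proof.
case/andP=> _ /forallP/(_ x)/cards1P[C defC] AM BM xA xB.
have: A \in [set C] by rewrite -defC inE AM.
have: B \in [set C] by rewrite -defC inE BM.
by rewrite !inE => /eqP-> /eqP->.
Qed.

Lemma perfect_matching_edge M A : perfect_matching e M -> A \in M ->
  exists u w, e u w /\ A = [set u; w].
Proof.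
case/andP=> /forall_inP MP _ /MP/existsP[u /existsP[w /andP[euw /eqP->]]].
by exists u, w.
Qed.

Lemma perfect_matching_cover M x : perfect_matching e M ->
  exists2 A, A \in M & x \in A.
Proof.
case/andP=> _ /forallP/(_ x)/cards1P[C defC].
have: C \in [set C] by rewrite inE.
by rewrite -defC inE => /andP[]; exists C.
Qed.

(** An edge of [M'] shares a vertex with some edge of [M]; that edge also lies in [M'], so the two
    coincide. *)
Lemma perfect_matching_sub M M' :
  perfect_matching e M -> perfect_matching e M' -> M \subset M' -> M' = M.
Proof.
move=> pM pM' sMM'; apply/eqP; rewrite eqEsubset sMM' andbT.
apply/subsetP => A AM'; have [u [w [_ defA]]] := perfect_matching_edge pM' AM'.
have uA : u \in A by rewrite defA !inE eqxx.
have [B BM uB] := perfect_matching_cover u pM.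
by rewrite (perfect_matching_inj pM' AM' (subsetP sMM' _ BM) uA uB).
Qed.

Lemma mate_edgesP m v w : is_mate m -> v != w ->
  [set v; w] \in mate_edges m -> m v = w.
Proof.
case=> em mK vw /imsetP[u _ /setP E].
have := E v; have := E w; rewrite !inE !eqxx orbT /= => /esym Ew /esym Ev.
case/orP: Ev vw => /eqP->; case/orP: Ew => /eqP->; by rewrite ?eqxx ?mK.
Qed.

Lemma perfect_matching_mate M : simple_graph e -> perfect_matching e M ->
  exists2 m, is_mate m & M = mate_edges m.
Proof.
case=> e_sym eirr pM.
have /fin_all_exists[m mP] v : exists w, e v w && ([set v; w] \in M).
  have [A AM] := perfect_matching_cover v pM.
  have [u [w [euw defA]]] := perfect_matching_edge pM AM.
  rewrite defA !inE => /orP[] /eqP->; [exists w | exists u].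
    by rewrite euw -defA.
  by rewrite e_sym euw setUC -defA.
have em v : e v (m v) by case/andP: (mP v).
have mM v : [set v; m v] \in M by case/andP: (mP v).
have mK : involutive m.
  move=> v; have : [set m v; m (m v)] = [set v; m v].
    by apply: (perfect_matching_inj (x := m v) pM); rewrite // !inE eqxx ?orbT.
  move/setP/(_ (m (m v))); rewrite !inE eqxx orbT => /esym/orP[/eqP//|/eqP E].
  by have := em (m v); rewrite E eirr.
exists m => //; apply: perfect_matching_sub (mate_edges_perfect (conj em mK)) pM _.
by apply/subsetP => _ /imsetP[v _ ->].
Qed.

(* If [x] were nonzero at [p], the kernel equation at the mate [m p] would give
   another neighbour of [m p], on the side of [p], where [x] is nonzero.  These
   choices close up to an M-alternating cycle avoiding [cover S]; switching M
   along it contradicts that S is forcing. *)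
Lemma forcing_set_kernel (K : fieldType) (W : V -> V -> K) (x : V -> K) M S :
  simple_graph e -> bipartite e -> (forall u v, (W u v != 0%R) = e u v) ->
  perfect_matching e M -> forcing_set e M S ->
  (forall v, (\sum_u W v u * x u)%R = 0%R) ->
  (forall v, v \in cover S -> x v = 0%R) ->
  forall v, x v = 0%R.
Proof.
move=> sg [col colP] WE pM /andP[SM /forallP forc] ker xS p0.
have [e_sym eirr] := sg.
have [m [em mK] defM] := perfect_matching_mate sg pM.
apply/eqP/negPn/negP => xp0.
(* The support of [x] on the side of [p0]; [f p] is to be a second neighbour of [m p] in it. *)
pose Z := [set p | (x p != 0%R) && (col p == col p0)].
have /fin_all_exists[f fP] p : exists q, p \in Z ->
    [&& q \in Z, q != p & e (m p) q].
  case: (boolP (p \in Z)) => [|_]; last by exists p.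
  rewrite inE => /andP[xp /eqP cp].
  case: (pickP [pred q | [&& e (m p) q, q != p & x q != 0%R]]) => [q /=|noq].
    case/and3P=> eq qp xq; exists q => _; rewrite inE xq qp eq -cp !andbT /=.
    move: (colP _ _ eq) (colP _ _ (em p)).
    by case: (col q) (col p) (col (m p)) => [] [] [].
  exfalso; have := ker (m p); rewrite (bigD1 p) //= big1 ?addr0.
    by apply/eqP; rewrite mulf_neq0// WE e_sym.
  move=> q qp; have := noq q; rewrite /= qp -WE /= => /negbT.
  by rewrite negb_and !negbK => /orP[] /eqP->; rewrite ?mulr0 ?mul0r.
(* A minimal nonempty [f]-stable [C] satisfies [f @: C = C], so [f] permutes it; this gives the
   alternating cycle without tracing a path. *)
pose P D := (D != set0) && (f @: D \subset D).
have PZ : P Z.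
  apply/andP; split; first by apply/set0Pn; exists p0; rewrite inE xp0 eqxx.
  by apply/subsetP => _ /imsetP[p pZ ->]; case/and3P: (fP p pZ).
have [C minC CZ] := minset_exists (P := P) PZ.
have /andP[C0 fC] := minsetp minC.
have fCC : f @: C = C.
  apply: (minsetinf minC) => //; rewrite /P imsetS// andbT.
  by have [p pC] := set0Pn _ C0; apply/set0Pn; exists (f p); apply: imset_f.
have finj : {in C &, injective f} by apply/imset_injP; rewrite fCC.
have fCin p : p \in C -> f p \in C by move=> pC; rewrite -fCC imset_f.
have /fin_all_exists[g gP] p : exists q, p \in C -> q \in C /\ f q = p.
  case: (boolP (p \in C)) => [|_]; last by exists p.
  by rewrite -{1}fCC => /imsetP[q qC ->]; exists q.
have colC p : p \in C -> col p = col p0.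
  by move/(subsetP CZ); rewrite inE => /andP[_ /eqP].
have mC p : p \in C -> m p \notin C.
  by move=> pC; apply/negP => /colC; have := colP _ _ (em p); rewrite (colC p pC) => /eqP/nesym.
have fe p : p \in C -> f p != p /\ e (m p) (f p).
  by move/(subsetP CZ)/fP/and3P=> [].
(* Switching: for [p] in [C], [m p] is paired with [f p] instead of [p]; [g] inverts [f] on [C]. *)
pose m' v := if v \in C then m (g v) else if m v \in C then f (m v) else m v.
have m'P : is_mate m'.
  split=> v; rewrite /m'.
    case: ifP => vC.
      have [gC fg] := gP v vC; have [_] := fe _ gC.
      by rewrite fg e_sym.
    by case: ifP => // mvC; have [_] := fe _ mvC; rewrite mK.
  case vC: (v \in C).
    by have [gC fg] := gP v vC; rewrite (negPf (mC _ gC)) mK gC fg.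
  case mvC: (m v \in C); last by rewrite mvC mK vC.
  have fC' := fCin _ mvC; have [gC fg] := gP _ fC'.
  by rewrite fC' (finj _ _ gC mvC fg) mK.
(* Both ends of an edge of [S] are zeros of [x], hence outside [C], so [m'] keeps that edge. *)
have SM' : S \subset mate_edges m'.
  apply/subsetP => A AS; have := subsetP SM _ AS; rewrite defM => /imsetP[v _ defA].
  have notC w : w \in A -> w \notin C.
    move=> wA; apply/negP => /(subsetP CZ); rewrite inE xS ?eqxx//.
    by apply/bigcupP; exists A.
  have [vA mvA] : v \in A /\ m v \in A by rewrite defA !inE !eqxx orbT.
  by apply/imsetP; exists v; rewrite // /m' (negPf (notC _ vA)) (negPf (notC _ mvA)).
have := forc (mate_edges m'); rewrite mate_edges_perfect// SM' => /eqP M'M.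
have [p pC] := set0Pn _ C0.
have [fp_neq efp] := fe p pC.
have : [set m p; f p] \in mate_edges m.
  rewrite -defM -M'M; apply/imsetP; exists (m p) => //.
  by rewrite /m' (negPf (mC p pC)) mK pC.
move/(mate_edgesP (conj em mK)) => E.
case/eqP: fp_neq; rewrite -E ?mK//.
by apply: contraTneq efp => ->; rewrite eirr.
Qed.

Lemma card_cover_forcing M S : perfect_matching e M -> forcing_set e M S ->
  #|cover S| <= 2 * #|S|.
Proof.
move=> pM /andP[SM _]; apply: leq_trans (leq_card_cover S) _.
rewrite mulnC -sum_nat_const; apply: leq_sum => A /(subsetP SM) AM.
have [u [w [_ ->]]] := perfect_matching_edge pM AM.
by rewrite cards2; case: (_ != _).
Qed.

Lemma forcing_set_self M : perfect_matching e M -> forcing_set e M M.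
Proof.
move=> pM; rewrite /forcing_set subxx; apply/forallP => M'.
by apply/implyP => /andP[pM' sMM']; apply/eqP/perfect_matching_sub.
Qed.

End Mates.

(** * Cartesian products and even cycles *)

Lemma cart_prod_simple (V1 V2 : finType) (e1 : rel V1) (e2 : rel V2) :
  simple_graph e1 -> simple_graph e2 -> simple_graph (cart_prod e1 e2).
Proof.
case=> s1 i1 [s2 i2]; split=> [x y|x]; rewrite /cart_prod.
  by rewrite s1 s2 (eq_sym x.1) (eq_sym x.2).
by rewrite i1 i2 !andbF.
Qed.

Lemma cart_prod_bipartite (V1 V2 : finType) (e1 : rel V1) (e2 : rel V2) :
  bipartite e1 -> bipartite e2 -> bipartite (cart_prod e1 e2).
Proof.
case=> c1 P1 [c2 P2]; exists (fun x => c1 x.1 (+) c2 x.2) => x y.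
case/orP=> /andP[/eqP-> exy].
  by rewrite (inj_eq (can_inj (addKb _))) P2.
by rewrite !(addbC (c1 _)) (inj_eq (can_inj (addKb _))) P1.
Qed.

(** The two shifts are mutually inverse, which turns arithmetic modulo [m] into cancellation. *)
Lemma cycle_graphE m (i j : 'I_m) :
  cycle_graph m i j = (j == ordS i) || (j == ord_pred i).
Proof.
rewrite /cycle_graph -(inj_eq (@ordS_inj m) j (ord_pred i)) ord_predK.
by rewrite (eq_sym (ordS j)).
Qed.

(** As [m] is even, parity also changes across the wrap-around from [m - 1] to 0. *)
Lemma odd_ordS m (i : 'I_m) : ~~ odd m -> odd (ordS i) = ~~ odd i.
Proof. by move=> /negPf em; rewrite /= odd_mod. Qed.

Lemma odd_ord_pred m (i : 'I_m) : ~~ odd m -> odd (ord_pred i) = ~~ odd i.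
Proof. by move=> em; rewrite -{2}(ord_predK i) odd_ordS// negbK. Qed.

Lemma val_ord_pred m (i : 'I_m) : 0 < i -> ord_pred i = i.-1 :> nat.
Proof.
by case: i => [[|i] im]// _; rewrite /= modnDr modn_small// ltnW.
Qed.

Lemma ordS_neq m (i : 'I_m) : 1 < m -> ordS i != i.
Proof.
move=> m1; rewrite -val_eqE /=; have := ltn_ord i.
case: (ltnP i.+1 m) => [lt _|ge lt]; first by rewrite modn_small//; lia.
have defm : i.+1 = m by lia.
by rewrite [X in X %% _]defm modnn; lia.
Qed.

Lemma ord_pred_neq m (i : 'I_m) : 1 < m -> ord_pred i != i.
Proof. by move=> m1; rewrite -(inj_eq (@ordS_inj m)) ord_predK eq_sym ordS_neq. Qed.

Lemma ordS_neq_pred m (i : 'I_m) : 2 < m -> ordS i != ord_pred i.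
Proof.
move=> m2; rewrite -(inj_eq (@ordS_inj m)) ord_predK -val_eqE /= -addn1 modnDml addn1.
have := ltn_ord i; case: (ltnP i.+2 m) => [lt _|ge lt].
  by rewrite modn_small//; lia.
by rewrite -(subnK ge) modnDr modn_small; lia.
Qed.

Lemma cycle_simple m : 1 < m -> simple_graph (cycle_graph m).
Proof.
move=> m1; split=> [i j|i]; first by rewrite /cycle_graph orbC.
by rewrite cycle_graphE !(eq_sym i) (negPf (ordS_neq i m1)) (negPf (ord_pred_neq i m1)).
Qed.

Lemma cycle_bipartite m : ~~ odd m -> bipartite (cycle_graph m).
Proof.
move=> em; exists (fun i : 'I_m => odd i) => i j.
by rewrite cycle_graphE => /orP[]/eqP->; rewrite ?odd_ordS ?odd_ord_pred//; case: odd.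
Qed.

(** * Lower bound: kernel vectors with [2n] parameters *)

Section LowerBound.
Local Open Scope ring_scope.
Variables (K : fieldType) (n m : nat) (e : rel 'I_n) (A : 'M[K]_n) (a : 'I_m -> K).
Hypotheses (esg : simple_graph e) (m_even : ~~ odd m) (m_gt2 : (2 < m)%N).
Hypotheses (Ae : weighted_adj e A) (AA : A *m A = 1%:M) (a_inj : injective a).

(* The points (1 : a i) of the projective line are distinct, so any three
   consecutive ones satisfy a linear relation with nonzero coefficients; these
   are the weights below. *)
Definition cart_weight (p q : 'I_n * 'I_m) : K :=
  let: (g, i) := p in let: (h, j) := q in
  (i == j)%:R * (a (ordS i) - a (ord_pred i)) * A h g
  + (g == h)%:R * ((j == ordS i)%:R * (a (ord_pred i) - a i)
                   + (j == ord_pred i)%:R * (a i - a (ordS i))).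

(** Each scalar is a difference of [a] at two of the layers [i - 1], [i], [i + 1], which are
    distinct because [m > 2]. *)
Lemma cart_weight_neq0 p q :
  (cart_weight p q != 0) = cart_prod e (cycle_graph m) p q.
Proof.
have [e_sym eirr] := esg; have m_gt1 : (1 < m)%N by apply: leq_trans m_gt2.
case: p q => [g i] [h j]; rewrite /cart_weight /cart_prod /= cycle_graphE.
have [<-|ij] := eqVneq i j.
  rewrite !(eq_sym i) (negPf (ordS_neq i m_gt1)) (negPf (ord_pred_neq i m_gt1)).
  rewrite !mul0r addr0 mulr0 addr0 mul1r mulf_eq0 negb_or subr_eq0 (inj_eq a_inj).
  by rewrite ordS_neq_pred// Ae e_sym andbF.
rewrite !mul0r add0r orbF; have [_|] := eqVneq g h; last by rewrite mul0r eqxx.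
rewrite mul1r; have [->|jS] := eqVneq j (ordS i).
  rewrite (negPf (ordS_neq_pred i m_gt2)) mul0r addr0 mul1r subr_eq0 (inj_eq a_inj).
  by rewrite ord_pred_neq.
rewrite mul0r add0r; have [_|_] := eqVneq j (ord_pred i); last by rewrite mul0r eqxx.
by rewrite mul1r subr_eq0 (inj_eq a_inj) eq_sym ordS_neq.
Qed.

(** The power [A ^ j]: by [AA] only the parity of [j] counts, consistently around the cycle as [m]
    is even. *)
Definition layer_pow (j : 'I_m) : 'M[K]_n := if odd j then A else 1%:M.

(** A row [u] stands for a pair [(y, z)], and [u *m layer_mx j] is the layer [(y + a_j z) A^j]. *)
Definition layer_mx (j : 'I_m) : 'M[K]_(n + n, n) :=
  col_mx (layer_pow j) (a j *: layer_pow j).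

Lemma mul_layer_mx (u : 'rV[K]_(n + n)) j :
  u *m layer_mx j = (lsubmx u + a j *: rsubmx u) *m layer_pow j.
Proof.
by rewrite -{1}(hsubmxK u) mul_row_col mulmxDl -scalemxAl -scalemxAr.
Qed.

Lemma layer_powA (j : 'I_m) :
  layer_pow j *m A = if ~~ odd j then A else 1%:M.
Proof. by rewrite /layer_pow; case: odd; rewrite ?AA ?mul1mx. Qed.

Lemma layer_mx_kernel (u : 'rV[K]_(n + n)) p :
  \sum_q cart_weight p q * (u *m layer_mx q.2) 0 q.1 = 0.
Proof.
case: p => [g i]; pose r j := u *m layer_mx j.
(* The sum sorted by layers. Layers are row vectors, so the entries [A h g] of the weight assemble
   into [r i *m A]. *)
transitivity ((a (ordS i) - a (ord_pred i)) * (r i *m A) 0 g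
   + ((a (ord_pred i) - a i) * r (ordS i) 0 g
      + (a i - a (ordS i)) * r (ord_pred i) 0 g)).
  rewrite (eq_bigr (fun q => cart_weight (g, i) (q.1, q.2) * r q.2 0 q.1)); last by case.
  rewrite -(pair_bigA _ (fun h j => cart_weight (g, i) (h, j) * r j 0 h)) /=.
  rewrite exchange_big /=.
  under eq_bigr => j _.
    under eq_bigr => h _ do rewrite mulrDl.
    rewrite big_split /= [X in _ + X](bigD1 g)//= eqxx mul1r.
    rewrite [X in _ + (_ + X)]big1 ?addr0; last first.
      by move=> h hg; rewrite eq_sym (negPf hg) !mul0r.
    rewrite mulrDl; over.
  rewrite big_split big_split /=; congr (_ + (_ + _)).
  - rewrite (bigD1 i)//= [X in _ + X]big1 ?addr0.
      rewrite mxE big_distrr /=; apply: eq_bigr => h _.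
      by rewrite eqxx mul1r -mulrA [A h g * _]mulrC.
    by move=> j ji; apply: big1 => h _; rewrite eq_sym (negPf ji) !mul0r.
  - rewrite (bigD1 (ordS i))//= big1 ?addr0 ?eqxx ?mul1r// => j /negPf->.
    by rewrite !mul0r.
  - rewrite (bigD1 (ord_pred i))//= big1 ?addr0 ?eqxx ?mul1r// => j /negPf->.
    by rewrite !mul0r.
rewrite /r !mul_layer_mx -mulmxA layer_powA /layer_pow odd_ordS// odd_ord_pred//.
(* All three terms carry the same power [Q] of [A]; what remains are the two linear relations, for
   [y] and for [z]. *)
set Q := (if _ then _ else _).
rewrite !mulmxDl -!scalemxAl !mxE.
ring.
Qed.

(** Powers of [A] are invertible, so [y + a_j z = 0] for all [j]; two distinct values of [a] give
    [z = 0], then [y = 0]. *)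
Lemma layer_mx_inj (u : 'rV[K]_(n + n)) : (forall j, u *m layer_mx j = 0) -> u = 0.
Proof.
move=> u0; have m0 : (0 < m)%N by apply: leq_trans m_gt2.
have uP j : lsubmx u + a j *: rsubmx u = 0.
  have := u0 j; rewrite mul_layer_mx /layer_pow; case: odd; rewrite ?mulmx1//.
  by move/(congr1 (mulmx^~ A)); rewrite -mulmxA AA mulmx1 mul0mx.
pose i := Ordinal m0; have Si : ordS i != i by apply/ordS_neq/ltnW.
have z0 : rsubmx u = 0.
  have : (a (ordS i) - a i) *: rsubmx u = 0.
    rewrite scalerBl; apply/eqP; rewrite subr_eq0; apply/eqP.
    by apply: (addrI (lsubmx u)); rewrite !uP.
  by move/eqP; rewrite scaler_eq0 subr_eq0 (inj_eq a_inj) (negPf Si) => /eqP.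
have := uP i; rewrite z0 scaler0 addr0 => y0.
by rewrite -(hsubmxK u) y0 z0 row_mx0.
Qed.

Lemma leq_card_forcing_set (M S : {set {set 'I_n * 'I_m}}) : bipartite e ->
  perfect_matching (cart_prod e (cycle_graph m)) M ->
  forcing_set (cart_prod e (cycle_graph m)) M S -> (n <= #|S|)%N.
Proof.
move=> ebip pM fS.
(* [B] evaluates the kernel vector of [u] on the covered vertices; its injectivity gives
   [2n <= #|cover S| <= 2 * #|S|]. *)
pose B : 'M[K]_(n + n, #|cover S|) :=
  \matrix_(r, s) layer_mx (enum_val s).2 r (enum_val s).1.
have Bfree : row_free B.
  apply/inj_row_free => u uB0; apply: layer_mx_inj => j; apply/rowP => h.
  rewrite [RHS]mxE.
  apply: (forcing_set_kernel _ _ cart_weight_neq0 pM fS (x := fun q => (u *m layer_mx q.2) 0 q.1) _ _ (h, j)).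
  - by apply: cart_prod_simple => //; apply/cycle_simple/ltnW.
  - by apply: cart_prod_bipartite => //; apply: cycle_bipartite.
  - exact: layer_mx_kernel.
  move=> v vS; transitivity ((u *m B) 0 (enum_rank_in vS v)).
    by rewrite !mxE; apply: eq_bigr => r _; rewrite [B _ _]mxE enum_rankK_in.
  by rewrite uB0 mxE.
have := rank_leq_col B; rewrite (eqP Bfree) => le.
by have := leq_trans le (card_cover_forcing pM fS); rewrite addnn mul2n leq_double.
Qed.

End LowerBound.

(** * Upper bound: a matching forced by [n] edges *)

Section UpperBound.
Variables (n m : nat) (e : rel 'I_n) (c : 'I_n -> bool).
Hypotheses (esg : simple_graph e) (cP : forall g h, e g h -> c g != c h).
Hypotheses (m_even : ~~ odd m) (m_gt2 : 2 < m).
Local Notation H := (cart_prod e (cycle_graph m)).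

Definition brick_mate (p : 'I_n * 'I_m) : 'I_n * 'I_m :=
  (p.1, if odd p.2 == c p.1 then ordS p.2 else ord_pred p.2).

Lemma brick_mateP : is_mate H brick_mate.
Proof.
split=> [[g i]|[g i]].
  by rewrite /cart_prod /= eqxx cycle_graphE; case: ifP; rewrite eqxx ?orbT.
rewrite /brick_mate; case: (boolP (odd i == c g)) => /= E.
  by rewrite odd_ordS//; case: odd (c g) E => [] [] //= _; rewrite ordSK.
by rewrite odd_ord_pred//; case: odd (c g) E => [] [] //= _; rewrite ord_predK.
Qed.

Lemma ltn_bool (b : bool) : b < m.
Proof. by apply: leq_ltn_trans (leq_b1 b) _; apply: ltnW. Qed.

(** The boolean [c g], read as 0 or 1, is the first layer of the parity at which matched edges over
    [g] start. *)
Definition brick_seed : {set {set 'I_n * 'I_m}} :=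
  [set let p := (g, Ordinal (ltn_bool (c g))) in [set p; brick_mate p] | g : 'I_n].

(* Column by column from the seed, the lower end of each remaining edge has
   every other neighbour already matched. *)
Lemma brick_seed_forcing : forcing_set H (mate_edges brick_mate) brick_seed.
Proof.
have m_gt1 : 1 < m by apply: ltnW.
have Hsg : simple_graph H by apply: cart_prod_simple => //; apply: cycle_simple.
apply/andP; split.
  by apply/subsetP => _ /imsetP[g _ ->]; apply: imset_f.
apply/forallP => M'; apply/implyP => /andP[pM' SM'].
have [m' m'P defM'] := perfect_matching_mate Hsg pM'.
have [em mK] := m'P.
have bP p : brick_mate p != p.
  have := brick_mateP.1 p; apply: contraTneq => ->.
  by case: Hsg => _ ->.
have key (g : 'I_n) (i : 'I_m) : odd i = c g -> m' (g, i) = (g, ordS i).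
  have [N] := ubnP (i : nat); elim: N g i => // N IH g j ltjN cg.
  have [j2|j2] := ltnP j 2.
    have defj : j = Ordinal (ltn_bool (c g)).
      by apply: val_inj; rewrite /= -cg; case: (val j) j2 => [|[]].
    apply: (mate_edgesP m'P).
      by have := bP (g, j); rewrite /brick_mate /= cg eqxx eq_sym.
    rewrite -defM'; apply: (subsetP SM'); apply/imsetP; exists g => //=.
    by rewrite -defj /brick_mate /= cg eqxx.
  have vp : ord_pred j = j.-1 :> nat by rewrite val_ord_pred// ltnW.
  have vpp : ord_pred (ord_pred j) = j.-2 :> nat.
    by rewrite val_ord_pred vp// -subn1 subn_gt0.
  (* By induction [(g, j - 1)] is taken by [(g, j - 2)], and [(h, j)] by [(h, j - 1)] for each
     neighbour [h] of [g], its colour being opposite; only [(g, j + 1)] is left. *)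
  case defq: (m' (g, j)) => [h l].
  have := em (g, j); rewrite defq /cart_prod /= cycle_graphE.
  case/orP=> /andP[/eqP E].
    case/orP=> /eqP El; first by rewrite -E El.
    have E2 : m' (g, ord_pred (ord_pred j)) = (g, ord_pred j).
      rewrite IH ?ord_predK ?odd_ord_pred ?negbK// vpp; move: ltjN j2; lia.
    move: defq; rewrite -E El -E2 => /(can_inj mK)[] /(congr1 (@nat_of_ord m)).
    rewrite vpp; move: j2; lia.
  move=> egh.
  have E2 : m' (h, ord_pred j) = (h, j).
    rewrite IH ?ord_predK// ?odd_ord_pred// ?cg; last by move: (cP egh); case: (c g) (c h) => [] [].
    by rewrite vp; move: ltjN j2; lia.
  move: defq; rewrite -E -E2 => /(can_inj mK)[] hg _.
  by case: esg => _ eirr; rewrite hg eirr in egh.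
apply/eqP; apply: perfect_matching_sub (mate_edges_perfect brick_mateP) pM' _.
apply/subsetP => _ /imsetP[[g i] _ ->].
rewrite defM' /brick_mate /=; case: ifP => [/eqP cg|].
  by rewrite -(key _ _ cg); apply: imset_f.
(* Here [(g, i)] is the upper end of its edge, so [key] is applied one layer below. *)
move=> ncg; rewrite setUC -{2}(ord_predK i) -key; last first.
  by rewrite odd_ord_pred//; move: ncg; case: odd (c g) => [] [].
exact: imset_f.
Qed.

Lemma card_brick_seed : #|brick_seed| <= n.
Proof. by apply: leq_trans (leq_imset_card _ _) _; rewrite cardT size_enum_ord. Qed.

End UpperBound.

(** * Extension of scalars and conclusion *)

Lemma exists_infinite_extension (F : fieldType) :
  exists (K : fieldType) (f : {rmorphism F -> K}) (a : nat -> K), injective a.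
Proof.
(* [F] may have fewer than [2 * k] elements; in [F(X)] the powers of [X] are distinct by degree. *)
exists {fraction {poly F}}, (GRing.RMorphism.clone _ _ (@tofrac {poly F} \o polyC) _).
exists (fun i => @tofrac {poly F} ('X^i)%R) => i j /eqP; rewrite tofrac_eq => /eqP.
by move/(congr1 (fun p : {poly F} => size p)); rewrite !size_polyXn => -[].
Qed.

Theorem theorem2p1 (F : fieldType) (n : nat) (e : rel 'I_n) (k : nat) :
  simple_graph e -> bipartite e -> (2 <= k)%N ->
  (exists A : 'M[F]_n, involutory_wadj e A) ->
  min_forcing_number (cart_prod e (cycle_graph (2 * k))) = n.
Proof.
move=> esg ebip k2 [A [Ae AA]].
set m := 2 * k; have m_even : ~~ odd m by rewrite oddM.
have m_gt2 : 2 < m by rewrite /m; lia.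
apply/eqP; rewrite eqn_leq; apply/andP; split.
  have [c cP] := ebip.
  have pM := mate_edges_perfect (brick_mateP e c m_even).
  apply: (leq_trans (bigmin_leq _ _ pM)).
  apply: leq_trans (card_brick_seed c m_gt2).
  exact: bigmin_leq (brick_seed_forcing esg cP m_even m_gt2).
have [K [f [a a_inj]]] := exists_infinite_extension F.
have lower M S : perfect_matching (cart_prod e (cycle_graph m)) M ->
    forcing_set (cart_prod e (cycle_graph m)) M S -> n <= #|S|.
  apply: (@leq_card_forcing_set K n m e (map_mx f A) (fun i => a i)) => //.
  - by move=> i j; rewrite mxE fmorph_eq0.
  - by rewrite -map_mxM AA map_mx1.
  - by move=> i j /a_inj/val_inj.
(* The default values obey the bound too: the first is [n * m], the second the size of the forcing
   set [M]. *)
apply: leq_bigmin => [|M pM].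
  by rewrite card_prod !card_ord leq_pmulr// ltnW// ltnW.
by apply: leq_bigmin => [|S]; [apply/(lower M)/forcing_set_self | apply: lower].
Qed.
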